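(* Let $k\ge2$ be an integer and consider the expanding map $T:\mathbb{T}\to\mathbb{T}$, $x\mapsto kx\bmod1$, with Lebesgue measure. Let $v$ be a potential on $\mathbb{T}$ (regarded as a function on $[0,1)$) that is anti $\alpha$-Hölder for some $\alpha\in[1,\infty)$, continuous, bounded, and monotone on $[0,1)$. Consider the Schrödinger operators $[H_{\lambda,v,\omega}\psi]_n=\psi_{n-1}+\psi_{n+1}+\lambda v(T^n\omega)\psi_n$ on $\ell^2(\mathbb{N})$ with Dirichlet boundary condition $\psi_{-1}=0$, with Lyapunov exponent $L(E;\lambda)$. Then there exists a constant $C_0=C_0(v)>0$ such that for all $\lambda>0$, $$L(E;\lambda)>\log\lambda-C_0\quad\text{for all }E\in\mathbb{R}.$$
   Context: Anti $\alpha$-Hölder: there is $H>0$ such that $|v(x)-v(y)|\ge H|x-y|^\alpha$ for all $x,y\in[0,1)$. Lyapunov exponent: with $A^{(E-\lambda v)}(\omega)=\begin{pmatrix}E-\lambda v(\omega)&-1\\1&0\end{pmatrix}$ and $A^{(E-\lambda v)}_n(\omega)=A^{(E-\lambda v)}(T^{n-1}\omega)\cdots A^{(E-\lambda v)}(\omega)$, $$L(E;\lambda)=\lim_{n\to\infty}\frac1n\int_{\mathbb{T}}\log\|A^{(E-\lambda v)}_n(\omega)\|\,d\omega.$$ *)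

(* Defs.v *)
From mathcomp Require Import all_boot all_order all_algebra.
From mathcomp Require Import all_classical all_reals all_analysis.

Set Implicit Arguments.
Unset Strict Implicit.
Unset Printing Implicit Defensive.

Import Order.TTheory GRing.Theory Num.Theory.
Import numFieldNormedType.Exports.

Local Open Scope classical_set_scope.
Local Open Scope ring_scope.

(* The circle is represented by its fundamental domain [0, 1).  A potential is
   a total function R -> R of which only the values on [0, 1) matter. *)
Definition circle (R : realType) : set R := `[0, 1[%classic.

Definition expanding_map (R : realType) (k : nat) (x : R) : R :=
  k%:R * x - (Num.floor (k%:R * x))%:~R.

Definition anti_holder (R : realType) (alpha : R) (v : R -> R) : Prop :=
  exists H : R, 0 < H /\
    forall x y : R, circle x -> circle y -> H * `|x - y| `^ alpha <= `|v x - v y|.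

(* Weakly monotone, in either direction. *)
Definition monotone_on_circle (R : realType) (v : R -> R) : Prop :=
  (forall x y : R, circle x -> circle y -> x <= y -> v x <= v y) \/
  (forall x y : R, circle x -> circle y -> x <= y -> v y <= v x).

(* The difference expression acting on all sequences; the Dirichlet condition
   psi_(-1) = 0 is the zero term at n = 0. *)
Definition schrodinger (R : realType) (T : R -> R) (v : R -> R)
    (lambda omega : R) (psi : nat -> R) (n : nat) : R :=
  (if n is m.+1 then psi m else 0) + psi n.+1 + lambda * v (iter n T omega) * psi n.

Definition transfer (R : realType) (v : R -> R) (lambda E omega : R) : 'M[R]_2 :=
  \matrix_(i, j) nth 0 (nth [::] [:: [:: E - lambda * v omega; -1];
                                     [:: 1                  ; 0]] i) j.

(* A_n(omega) = A(T^(n-1) omega) ... A(T omega) A(omega) *)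
Fixpoint cocycle (R : realType) (T : R -> R) (v : R -> R) (lambda E : R)
    (n : nat) (omega : R) : 'M[R]_2 :=
  if n is m.+1 then
    transfer v lambda E (iter m T omega) *m cocycle T v lambda E m omega
  else 1%:M.

Definition l2norm (R : realType) (n : nat) (u : 'cV[R]_n) : R :=
  Num.sqrt (\sum_(i < n) u i 0 ^+ 2).

(* The norm `|A| of the library is the largest absolute value of an entry;
   here the norm is the operator norm induced by the Euclidean norm. *)
Definition opnorm (R : realType) (n : nat) (A : 'M[R]_n) : R :=
  sup [set l2norm (A *m u) | u in [set u : 'cV[R]_n | l2norm u = 1]].

(* The value at n = 0 is 0 (as 0^-1 = 0) and does not affect the limit. *)
Definition lyapunov_seq (R : realType) (T : R -> R) (v : R -> R)
    (lambda E : R) (n : nat) : R :=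
  n%:R^-1 * (\int[lebesgue_measure]_(omega in @circle R)
               ln (opnorm (cocycle T v lambda E n omega))).

Definition lyapunov (R : realType) (T : R -> R) (v : R -> R) (lambda E : R) : R :=
  lim (lyapunov_seq T v lambda E n @[n --> \oo]).

(* Solutions of H psi = E psi are exactly the sequences generated by the
   cocycle from the initial vector (psi_0, psi_(-1)) = (psi_0, 0). *)
Definition solution_vector (R : realType) (psi : nat -> R) (n : nat) : 'cV[R]_2 :=
  \col_i nth 0 [:: psi n; if n is m.+1 then psi m else 0] i.

Lemma schrodinger_solutionP (R : realType) (T v : R -> R) (lambda E omega : R)
    (psi : nat -> R) :
  (forall n, schrodinger T v lambda omega psi n = E * psi n) <->
  (forall n, solution_vector psi n =
             cocycle T v lambda E n omega *m solution_vector psi 0).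
Proof.
have stepP n : schrodinger T v lambda omega psi n = E * psi n <->
    solution_vector psi n.+1 =
    transfer v lambda E (iter n T omega) *m solution_vector psi n.
  rewrite /schrodinger; set p := (X in X + _ + _); split=> [eqE|/matrixP/(_ 0 0)].
    apply/matrixP => i j; rewrite !mxE !big_ord_recl big_ord0 !mxE /=.
    case: i => [[|[|[]]]] //= _.
      by rewrite mulN1r addr0 mulrBl -eqE -/p addrK addrAC subrr add0r.
    by rewrite mul1r mul0r !addr0.
  rewrite !mxE !big_ord_recl big_ord0 !mxE /= => ->.
  by rewrite mulN1r addr0 mulrBl -/p [p + _]addrC !subrK.
split=> [eqE n|eqA n].
  elim: n => [|n IHn]; first by rewrite mul1mx.
  by rewrite /= -mulmxA -IHn; apply/stepP.
by apply/stepP; rewrite [LHS]eqA [in RHS]eqA mulmxA.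
Qed.

(* Main.v *)
Require Import Defs.
From HB Require Import structures.
From mathcomp Require Import all_boot all_order all_algebra.
From mathcomp Require Import all_classical all_reals all_analysis.
From mathcomp Require Import measurable_realfun.
From mathcomp Require Import ring lra zify.
Import Order.TTheory GRing.Theory Num.Theory.
Import numFieldNormedType.Exports.
Local Open Scope classical_set_scope.
Local Open Scope ring_scope.

(** Fix [E] and put [f = E - lambda * v].  The upper left entry [P_n] of the
    cocycle satisfies [P_(n+1) = f(T^n x) P_n - P_(n-1)], so the quotients
    [m_n = P_(n+1) / P_n] obey the Riccati recursion
    [m_(n+1) = f(T^(n+1) x) - 1 / m_n], and [|A_n| >= |P_n| = prod_(j<n) |m_j|].
    It thus suffices to bound, uniformly in [j] and [E], the mean of the
    negative part of [ln (|m_j| / lambda)], hence to show that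
    [|m_j| < lambda e^(-i)] has measure at most [c q^i] with [q < 1].

    Let [v] increase.  As long as [x] stays in one [k]-adic cylinder of level
    [j], all the potentials [v(T^i x)], [i <= j], increase with [x].  By discrete
    Sturm comparison the pair consisting of the number of negative [m_i],
    [i < j], and of [- m_j] then increases lexicographically, and while that
    number is constant, [m_j] decreases at least as fast as [f(T^j x)] does.
    Since [T^j] expands the cylinder by [k^j] and [f] is anti-Hoelder, on each
    such piece the set [|m_j| < lambda e^(-i)] has length of order
    [k^(-j) (e^(-i))^(1/alpha)].

    The point is that there are only [O(k^j)] pieces, not [j k^j].  Passing to
    the next cylinder resets potentials downwards and the count of negative
    [m_i] may drop, but adding the cylinder indices of all levels [1, ..., j]
    to the count gives a label ([branch]) which is monotone on the whole circle
    ([branch_monotone]) and less than [2 k^j] ([branch_le]): a geometric sum.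
    This yields [lebesgue_measure_small_riccati], whose constants do not see
    [j], [lambda] or [E]; integrating gives
    [mean_ln_cocycle_ge].  Decreasing [v] is reduced to this case by changing
    the sign of [f], hence of all the [m_j].

    The limit defining the Lyapunov exponent exists by Fekete's lemma
    ([subadditive_cvg]): the operator norm is submultiplicative, and [T]
    preserves Lebesgue measure. *)

Set Implicit Arguments.
Unset Strict Implicit.
Unset Printing Implicit Defensive.

(** * Cylinders of the expanding map and the Riccati recursion *)

Lemma circleE (R : realType) (x : R) : circle x = (0 <= x < 1) :> Prop.
Proof. by rewrite /circle /= in_itv. Qed.

Lemma iter_expanding_map (R : realType) (k j : nat) (x : R) : circle x ->
  iter j (expanding_map k) x
    = k%:R ^+ j * x - (Num.floor (k%:R ^+ j * x))%:~R.
Proof.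
rewrite circleE => x01; elim: j => [|j IHj].
  by rewrite expr0 mul1r (_ : Num.floor x = 0) ?subr0//; exact: floor_def.
rewrite iterS IHj /expanding_map mulrBr mulrA -exprS.
rewrite -(intrM _ k%:Z) -rmorphN floorDrz ?intr_int//.
by rewrite intrKfloor /= intrD; ring.
Qed.

Lemma circle_expanding_map (R : realType) (k j : nat) (x : R) : circle x ->
  circle (iter j (expanding_map k) x).
Proof.
move=> cx; rewrite iter_expanding_map// circleE.
have := floor_itv (k%:R ^+ j * x); rewrite intrD1; lra.
Qed.

Definition cylinder (R : realType) (k j : nat) (x : R) : nat :=
  Num.truncn (k%:R ^+ j * x).

Lemma iter_expanding_map_cylinder (R : realType) (k j : nat) (x : R) :
  circle x ->
  iter j (expanding_map k) x = k%:R ^+ j * x - (cylinder k j x)%:R.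
Proof.
move=> cx; rewrite iter_expanding_map// /cylinder truncn_floor.
move: (cx); rewrite circleE => /andP[x0 _].
have kx0 : 0 <= k%:R ^+ j * x by rewrite mulr_ge0// exprn_ge0.
by rewrite kx0 natr_absz ger0_norm// floor_ge0.
Qed.

Lemma le_cylinder (R : realType) (k j : nat) (x y : R) :
  x <= y -> (cylinder k j x <= cylinder k j y)%N.
Proof. by move=> xy; apply/le_truncn; rewrite ler_wpM2l// exprn_ge0. Qed.

Lemma cylinder_lt (R : realType) (k j : nat) (x : R) : (0 < k)%N ->
  circle x -> (cylinder k j x < k ^ j)%N.
Proof.
rewrite circleE => k0 /andP[x0 x1]; rewrite truncn_lt_nat.
  by rewrite natrX gtr_pMr// exprn_gt0// ltr0n.
by rewrite mulr_ge0// exprn_ge0.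
Qed.

(** The quotient [P_(j+1) / P_j] of successive upper left entries of the
    cocycle.  As [0^-1 = 0], it has this meaning only up to the first zero. *)
Fixpoint riccati (R : realType) (k : nat) (f : R -> R) (j : nat) (x : R) : R :=
  if j is i.+1 then
    f (iter j (expanding_map k) x) - (riccati k f i x)^-1
  else f x.

(** The number of negative entries among the first [j] terms of the Riccati
    sequence, a discrete rotation number, to which the cylinder indices of the
    levels [1, ..., j] are added: they outweigh its drops at the endpoints
    of the cylinders, so that the sum is monotone on the whole circle. *)
Fixpoint branch (R : realType) (k : nat) (f : R -> R) (j : nat) (x : R) : nat :=
  if j is i.+1 then
    (branch k f i x + (riccati k f i x < 0)%R + cylinder k j x)%N
  else 0%N.

(** Each level contributes at most [k ^ j], sign included, so this is a
    geometric sum; the summand [2] on the left makes the induction go through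
    down to [k = 2]. *)
Lemma branch_le (R : realType) (k : nat) (f : R -> R) (j : nat) (x : R) :
  (2 <= k)%N -> circle x -> (branch k f j x + 2 <= 2 * k ^ j)%N.
Proof.
move=> k2 cx; elim: j => [//|j IHj] /=.
have := @cylinder_lt R k j.+1 x (ltnW k2) cx.
have : (2 * k ^ j <= k ^ j.+1)%N by rewrite expnS leq_mul2r k2 orbT.
by case: (_ < 0)%R => /=; lia.
Qed.

Definition nonsingular (R : realType) (k : nat) (f : R -> R) (j : nat) (x : R) :=
  forall i, (i < j)%N -> riccati k f i x != 0.

(** Sturm comparison.  The invariant is carried from [j] to [j + 1] because
    [m |-> - 1 / m] is increasing on each half line, and sends the negative half
    line above the positive one: a smaller [m_j] either has the same sign, and
    then [- 1 / m_j] is smaller too, or has just become negative, which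
    the label records. *)
Lemma branch_monotone (R : realType) (k : nat) (f : R -> R) :
  (forall x y, circle x -> circle y -> x <= y -> f y <= f x) ->
  forall (j : nat) (x y : R), circle x -> circle y -> x < y ->
  nonsingular k f j x -> nonsingular k f j y ->
  (branch k f j x < branch k f j y)%N \/
  [/\ branch k f j x = branch k f j y, cylinder k j x = cylinder k j y &
      f (iter j (expanding_map k) x) - f (iter j (expanding_map k) y)
        <= riccati k f j x - riccati k f j y].
Proof.
move=> fdec; elim=> [x y cx cy xy _ _|j IHj x y cx cy xy nx ny].
  right; split => //; rewrite /cylinder !expr0 !mul1r.
  move: cx cy; rewrite !circleE => cx cy.
  by rewrite (@truncn_def _ x 0%N)// (@truncn_def _ y 0%N).
have [ltjj|[bE cE le_m]] := IHj x y cx cy xy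
  (fun i ij => nx i (ltnW ij)) (fun i ij => ny i (ltnW ij)).
  have := @le_cylinder R k j.+1 x y (ltW xy).
  rewrite leq_eqVlt => /predU1P[cE|clt]; last first.
    by left => /=; case: (_ < 0)%R => /=; case: (_ < 0)%R => /=; lia.
  move=> /=; rewrite -cE.
  (* The label of [x] can catch up by at most one, and only if [m_j] is
     negative at [x] and positive at [y]. *)
  have mx := nx j (ltnSn j); have my := ny j (ltnSn j).
  have [mx0|mx0] := ltP (riccati k f j x) 0; last first.
    by left; case: (_ < 0)%R => /=; lia.
  have [my0|my0] := ltP (riccati k f j y) 0; first by left => /=; lia.
  move: ltjj; rewrite leq_eqVlt => /predU1P[bE|]; last by left => /=; lia.
  right; split => //=; first by lia.
  have : (riccati k f j x)^-1 <= 0 by rewrite invr_le0 ltW.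
  have : 0 <= (riccati k f j y)^-1 by rewrite invr_ge0.
  lra.
have Txy : f (iter j (expanding_map k) y) <= f (iter j (expanding_map k) x).
  apply: fdec; try exact: circle_expanding_map.
  rewrite !iter_expanding_map_cylinder// cE lerB//.
  by rewrite ler_wpM2l ?exprn_ge0// ltW.
have mxy : riccati k f j y <= riccati k f j x by lra.
have mx := nx j (ltnSn j); have my := ny j (ltnSn j).
have := @le_cylinder R k j.+1 x y (ltW xy).
have lt_le : ((riccati k f j x < 0)%R <= (riccati k f j y < 0)%R)%N.
  by have [x0|//] := ltP (riccati k f j x) 0; rewrite (le_lt_trans mxy x0).
rewrite leq_eqVlt => /predU1P[c'E|clt]; last by left => /=; lia.
move: lt_le; rewrite leq_eqVlt => /predU1P[sE|slt]; last by left => /=; lia.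
right; split => //=; first by lia.
suff : (riccati k f j x)^-1 <= (riccati k f j y)^-1 by lra.
have [x0|x0] := ltP (riccati k f j x) 0.
  by rewrite lef_nV2// ?negrE// (le_lt_trans mxy).
have y0 : 0 <= riccati k f j y.
  by move: sE; rewrite ltNge x0/=; case: ltP.
by rewrite lef_pV2// ?posrE lt_neqAle eq_sym ?mx ?my.
Qed.

(** * Measure of the set where the Riccati variable is small *)

Lemma measurable_circle (R : realType) :
  measurable (@circle R : set (measurableTypeR R)).
Proof. exact: measurable_itv. Qed.

Lemma measurable_expanding_map (R : realType) (k j : nat) :
  measurable_fun [set: measurableTypeR R]
    (iter j (@expanding_map R k) : measurableTypeR R -> measurableTypeR R).
Proof.
elim: j => [|j IHj]; first exact: measurable_id.
apply: (@measurableT_comp _ _ _ _ _ _ (@expanding_map R k)) => //.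
apply: measurable_funB; first exact: mulrl_measurable.
apply: nondecreasing_measurable => // x y xy.
by rewrite ler_int le_floor// ler_wpM2l.
Qed.

Lemma measurable_comp_iter (R : realType) (k j : nat) (f : R -> R) :
  measurable_fun (@circle R : set (measurableTypeR R)) f ->
  measurable_fun (@circle R : set (measurableTypeR R))
    (f \o iter j (expanding_map k)).
Proof.
move=> mf; apply: measurable_comp mf _; first exact: measurable_circle.
  by move=> _ [x cx <-]; exact: circle_expanding_map.
by apply: measurable_funS (@measurable_expanding_map R k j).
Qed.

(** The identity [z^-1 = z * (z ^ 2)^-1] reduces to powers of nonnegative reals. *)
Lemma measurable_funV (d : measure_display) (T : measurableType d)
    (R : realType) (D : set T) (f : T -> R) : measurable D ->
  measurable_fun D f -> measurable_fun D (fun x => (f x)^-1).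
Proof.
move=> mD mf.
have -> : (fun x => (f x)^-1) = f \* (fun x => (f x ^+ 2) `^ (-1)).
  apply/funext => x /=; rewrite powR_inv1 ?sqr_ge0//.
  have [->|fx0] := eqVneq (f x) 0; first by rewrite mul0r invr0.
  by rewrite expr2 invfM mulrA divff// mul1r.
apply: measurable_funM => //.
apply: (@measurableT_comp _ _ _ _ _ _ (@powR R ^~ (-1))).
  exact: measurable_powR.
exact: measurable_funX.
Qed.

Lemma measurable_riccati (R : realType) (k j : nat) (f : R -> R) :
  measurable_fun (@circle R : set (measurableTypeR R)) f ->
  measurable_fun (@circle R : set (measurableTypeR R)) (riccati k f j).
Proof.
move=> mf; elim: j => [//|j IHj].
apply: measurable_funB; first exact: (@measurable_comp_iter R k j.+1 f).
by apply: measurable_funV => //; exact: measurable_circle.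
Qed.

Definition small_riccati (R : realType) (k : nat) (f : R -> R) (j : nat)
    (e : R) : set R :=
  [set x | [/\ circle x, nonsingular k f j x & `|riccati k f j x| < e]].

Lemma measurable_small_riccati (R : realType) (k j : nat) (f : R -> R) (e : R) :
  measurable_fun (@circle R : set (measurableTypeR R)) f ->
  measurable (small_riccati k f j e : set (measurableTypeR R)).
Proof.
move=> mf.
pose Z i : set (measurableTypeR R) :=
  @circle R `&` (riccati k f i @^-1` [set~ 0]).
pose B : set (measurableTypeR R) :=
  @circle R `&` ((fun x => `|riccati k f j x|) @^-1` `]-oo, e[%classic).
have -> : small_riccati k f j e = (\bigcap_(i < j) Z i) `&` B.
  apply/seteqP; split=> [x [cx nx mx]|x [Zx [cx /= mx]]].
    split; first by move=> i ij; split=> //; exact/eqP/nx.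
    by split => //=; rewrite in_itv.
  split => //.
  by move=> i ij; have [_ Zi] := Zx i ij; apply/eqP.
apply: measurableI.
  apply: bigcap_measurableType => // i _.
  apply: measurable_riccati => //; first exact: measurable_circle.
  by apply: measurableC; exact: measurable_set1.
apply: (measurableT_comp (@normr_measurable R setT)).
- exact: measurable_riccati.
- exact: measurable_circle.
- exact: measurable_itv.
Qed.

(** Each level set of [b] lies in the interval of radius [r] around any of
    its points. *)
Lemma lebesgue_measure_label (R : realType) (S : set (measurableTypeR R))
    (b : R -> nat) (N : nat) (r : R) : measurable S -> 0 <= r ->
  (forall x, S x -> (b x < N)%N) ->
  (forall x y, S x -> S y -> b x = b y -> `|x - y| <= r) ->
  (lebesgue_measure S <= (N%:R * (2 * r))%:E)%E.
Proof.
move=> mS r0 bN near.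
(* The default value is harmless: an empty level set needs no covering. *)
pose p i := xget 0 [set x | S x /\ b x = i].
pose I i : set (measurableTypeR R) := `[p i - r, p i + r]%classic.
have mI i : measurable (I i) by exact: measurable_itv.
have SI : S `<=` \big[setU/set0]_(i < N) I i.
  move=> x Sx; rewrite -bigcup_mkord; exists (b x); first exact: bN.
  have [Sp bp] : S (p (b x)) /\ b (p (b x)) = b x.
    by apply: (@xgetPex _ 0 [set y | S y /\ b y = b x]); exists x.
  have := near _ _ Sp Sx bp; rewrite ler_norml /I/= in_itv/=; lra.
apply: le_trans (le_measure lebesgue_measure _ _ SI) _; rewrite ?inE//.
  by apply: bigsetU_measurable.
apply: le_trans (Boole_inequality _ _) _ => //.
rewrite (eq_bigr (fun=> (2 * r)%:E)); last first.
  move=> i _; rewrite [LHS](lebesgue_measure_itv `[p i - r, p i + r])/= lte_fin.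
  case: ltP => [_|]; last by move=> ?; congr EFin; lra.
  by rewrite -EFinB; congr EFin; ring.
by rewrite sumEFin sumr_const card_ord -[(_ *+ N)%R]mulr_natl.
Qed.

(** Two points with the same label lie in the same cylinder, and there the
    increment of [f] along [T^j] is at most that of the Riccati variable,
    that is at most [2 e]; the anti-Hoelder bound turns this into
    [k ^ j * |x - y| <= (2 e / h) `^ alpha^-1].  The [2 * k ^ j] labels absorb
    the factor [k ^ j]. *)
Lemma lebesgue_measure_small_riccati_decr (R : realType) (k j : nat)
    (f : R -> R) (h alpha e : R) :
  (2 <= k)%N -> 0 < h -> 0 < alpha -> 0 <= e ->
  measurable_fun (@circle R : set (measurableTypeR R)) f ->
  (forall x y, circle x -> circle y -> h * `|x - y| `^ alpha <= `|f x - f y|) ->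
  (forall x y, circle x -> circle y -> x <= y -> f y <= f x) ->
  (lebesgue_measure (small_riccati k f j e)
     <= (4 * (2 * e / h) `^ alpha^-1)%:E)%E.
Proof.
move=> k2 h0 al0 e0 mf antif fdec.
set d := _ `^ _; have kj0 : (0 : R) < k%:R ^+ j.
  by rewrite exprn_gt0// ltr0n; lia.
apply: le_trans (@lebesgue_measure_label R _ (branch k f j) (2 * k ^ j)%N
  (d / k%:R ^+ j) _ _ _ _) _.
- exact: measurable_small_riccati.
- by rewrite divr_ge0 ?powR_ge0// ltW.
- by move=> x [cx _ _]; have := branch_le f j k2 cx; lia.
- have main x y : small_riccati k f j e x -> small_riccati k f j e y ->
      branch k f j x = branch k f j y -> x < y -> y - x <= d / k%:R ^+ j.
    move=> [cx nx mx] [cy ny my] bE xy.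
    have [|[_ cE le_m]] := branch_monotone fdec cx cy xy nx ny.
      by rewrite bE ltnn.
    have Tc (z : R) : circle z -> circle (iter j (expanding_map k) z).
      exact: circle_expanding_map.
    have := antif _ _ (Tc _ cx) (Tc _ cy).
    have TE : iter j (expanding_map k) y - iter j (expanding_map k) x
        = k%:R ^+ j * (y - x).
      by rewrite !iter_expanding_map_cylinder// cE; ring.
    have t0 : 0 <= k%:R ^+ j * (y - x) by rewrite mulr_ge0 ?ltW// subr_gt0.
    rewrite distrC TE ger0_norm// => le_h.
    have le_f : `|f (iter j (expanding_map k) x)
                  - f (iter j (expanding_map k) y)| <= 2 * e.
      rewrite ger0_norm; last first.
        rewrite subr_ge0 fdec//; [exact: Tc|exact: Tc|].
        by rewrite -subr_ge0 TE.
      by move: mx my; rewrite !ltr_norml; lra.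
    rewrite ler_pdivlMr// mulrC.
    rewrite -[leLHS](powRr1 t0) -[X in _ `^ X](divff (lt0r_neq0 al0)).
    rewrite powRrM; apply: ge0_ler_powR.
    - by rewrite invr_ge0 ltW.
    - by rewrite nnegrE powR_ge0.
    - by rewrite nnegrE divr_ge0 ?mulr_ge0// ltW.
    - by rewrite ler_pdivlMr// mulrC (le_trans le_h).
  move=> x y Sx Sy bE; have [xy|yx|->] := ltgtP x y.
  + by rewrite distrC ger0_norm ?subr_ge0 ?(ltW xy)//; exact: main.
  + by rewrite ger0_norm ?subr_ge0 ?(ltW yx)//; exact: main.
  + by rewrite subrr normr0 divr_ge0 ?powR_ge0// ltW.
- rewrite lee_fin natrM natrX le_eqVlt; apply/orP; left; apply/eqP.
  by field; rewrite gt_eqF// ltr0n; lia.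
Qed.

Lemma riccati_opp (R : realType) (k j : nat) (f : R -> R) (x : R) :
  riccati k (fun y => - f y) j x = - riccati k f j x.
Proof. by elim: j => [//|j IHj] /=; rewrite IHj invrN opprD. Qed.

Lemma small_riccati_opp (R : realType) (k j : nat) (f : R -> R) (e : R) :
  small_riccati k (fun y => - f y) j e = small_riccati k f j e.
Proof.
apply/seteqP; split=> x [cx nx mx]; split=> //; try by move: mx;
  rewrite riccati_opp normrN.
  by move=> i /nx; rewrite riccati_opp oppr_eq0.
by move=> i /nx; rewrite riccati_opp oppr_eq0.
Qed.

(** Changing the sign of [f] changes the sign of the Riccati variable, which
    reduces the increasing case to the decreasing one. *)
Lemma lebesgue_measure_small_riccati (R : realType) (k j : nat)
    (f : R -> R) (h alpha e : R) :
  (2 <= k)%N -> 0 < h -> 0 < alpha -> 0 <= e ->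
  measurable_fun (@circle R : set (measurableTypeR R)) f ->
  (forall x y, circle x -> circle y -> h * `|x - y| `^ alpha <= `|f x - f y|) ->
  monotone_on_circle f ->
  (lebesgue_measure (small_riccati k f j e)
     <= (4 * (2 * e / h) `^ alpha^-1)%:E)%E.
Proof.
move=> k2 h0 al0 e0 mf antif [finc|fdec]; last first.
  exact: lebesgue_measure_small_riccati_decr.
rewrite -small_riccati_opp; apply: lebesgue_measure_small_riccati_decr => //.
- exact: measurable_funN.
- by move=> x y cx cy; rewrite -opprD normrN antif.
- by move=> x y cx cy xy; rewrite lerN2 finc.
Qed.

(** * The Euclidean operator norm of two by two matrices *)

Lemma big_ord2 (R : pzRingType) (F : 'I_2 -> R) : \sum_(i < 2) F i = F 0 + F 1.
Proof.
by rewrite big_ord_recl big_ord1; congr (_ + F _); exact: val_inj.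
Qed.

(** The discriminant of the characteristic polynomial of [A^T *m A]. *)
Definition gram_disc (R : realType) (A : 'M[R]_2) : R :=
  (A 0 0 ^+ 2 + A 1 0 ^+ 2 - (A 0 1 ^+ 2 + A 1 1 ^+ 2)) ^+ 2
    + 4 * (A 0 0 * A 0 1 + A 1 0 * A 1 1) ^+ 2.

(** The largest eigenvalue of [A^T *m A]; this explicit formula for the square
    of the operator norm makes measurability in the entries evident. *)
Definition gram_top (R : realType) (A : 'M[R]_2) : R :=
  (A 0 0 ^+ 2 + A 1 0 ^+ 2 + (A 0 1 ^+ 2 + A 1 1 ^+ 2)
    + Num.sqrt (gram_disc A)) / 2.

Lemma l2normE2 (R : realType) (u : 'cV[R]_2) :
  l2norm u = Num.sqrt (u 0 0 ^+ 2 + u 1 0 ^+ 2).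
Proof. by rewrite /l2norm big_ord2. Qed.

Lemma gram_topP (R : realType) (A : 'M[R]_2) :
  let p := A 0 0 ^+ 2 + A 1 0 ^+ 2 in
  let q := A 0 0 * A 0 1 + A 1 0 * A 1 1 in
  let r := A 0 1 ^+ 2 + A 1 1 ^+ 2 in
  [/\ p <= gram_top A, r <= gram_top A &
      (gram_top A - p) * (gram_top A - r) = q ^+ 2].
Proof.
move=> p q r.
have d0 : 0 <= gram_disc A.
  by rewrite addr_ge0 ?sqr_ge0// mulr_ge0// sqr_ge0.
set s := Num.sqrt (gram_disc A).
have sE : s ^+ 2 = (p - r) ^+ 2 + 4 * q ^+ 2 by rewrite sqr_sqrtr.
have sge : `|p - r| <= s.
  rewrite -sqrtr_sqr ler_wsqrtr// /gram_disc -/p -/q -/r lerDl.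
  by rewrite mulr_ge0// sqr_ge0.
have -> : gram_top A = (p + r + s) / 2 by [].
move: sge; rewrite ler_norml => /andP[s1 s2].
by split; [lra|lra|nra].
Qed.

Lemma l2norm_mulmx2 (R : realType) (A : 'M[R]_2) (u : 'cV[R]_2) :
  l2norm (A *m u) = Num.sqrt
    ((A 0 0 ^+ 2 + A 1 0 ^+ 2) * u 0 0 ^+ 2
     + 2 * (A 0 0 * A 0 1 + A 1 0 * A 1 1) * (u 0 0 * u 1 0)
     + (A 0 1 ^+ 2 + A 1 1 ^+ 2) * u 1 0 ^+ 2).
Proof. by rewrite l2normE2 !mxE !big_ord2; congr Num.sqrt; ring. Qed.

Lemma gram_top_ge0 (R : realType) (A : 'M[R]_2) : 0 <= gram_top A.
Proof.
have [pt _ _] := gram_topP A; apply: le_trans pt.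
by rewrite addr_ge0 ?sqr_ge0.
Qed.

(** The form [t |u|^2 - |A u|^2], for [t := gram_top A], is nonnegative because
    its determinant vanishes and its diagonal is nonnegative. *)
Lemma l2norm_mulmx_le_gram (R : realType) (A : 'M[R]_2) (u : 'cV[R]_2) :
  l2norm (A *m u) <= Num.sqrt (gram_top A) * l2norm u.
Proof.
rewrite l2norm_mulmx2 l2normE2 -sqrtrM ?gram_top_ge0// ler_wsqrtr//.
have [] := gram_topP A.
set p := A 0 0 ^+ 2 + _; set r := A 0 1 ^+ 2 + _; set q := A 0 0 * _ + _.
set t := gram_top A; move: (u 0 0) (u 1 0) => a b pt rt tq.
rewrite -subr_ge0.
have -> : t * (a ^+ 2 + b ^+ 2) - (p * a ^+ 2 + 2 * q * (a * b) + r * b ^+ 2)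
   = (t - p) * a ^+ 2 - 2 * q * (a * b) + (t - r) * b ^+ 2 by ring.
have [tp|tp] := eqVneq t p.
  have q0 : q = 0 by apply/eqP; rewrite -sqrf_eq0 -tq tp subrr mul0r.
  rewrite q0 tp subrr mulr0 mul0r mul0r subr0 add0r.
  by rewrite mulr_ge0 ?sqr_ge0 ?subr_ge0 -?tp.
have tp0 : 0 < t - p by rewrite subr_gt0 lt_neqAle eq_sym tp.
rewrite -(pmulr_rge0 _ tp0).
have -> : (t - p) * ((t - p) * a ^+ 2 - 2 * q * (a * b) + (t - r) * b ^+ 2)
  = ((t - p) * a - q * b) ^+ 2 + ((t - p) * (t - r) - q ^+ 2) * b ^+ 2 by ring.
by rewrite tq subrr mul0r addr0 sqr_ge0.
Qed.

Lemma opnorm2E (R : realType) (A : 'M[R]_2) :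
  opnorm A = Num.sqrt (gram_top A).
Proof.
have ub : ubound [set l2norm (A *m u) | u in [set u : 'cV[R]_2 | l2norm u = 1]]
    (Num.sqrt (gram_top A)).
  move=> _ [u u1 <-].
  by rewrite (le_trans (l2norm_mulmx_le_gram A u))// u1 mulr1.
suff [u u1 uA] : exists2 u : 'cV[R]_2,
    l2norm u = 1 & l2norm (A *m u) = Num.sqrt (gram_top A).
  apply/eqP; rewrite eq_le; apply/andP; split.
    by apply: ge_sup => //; exists (l2norm (A *m u)); exists u.
  by apply: ub_le_sup; [exists (Num.sqrt (gram_top A))|exists u].
have [pt rt tq] := gram_topP A.
move: (l2norm_mulmx2 A) pt rt tq.
set p := A 0 0 ^+ 2 + _; set r := A 0 1 ^+ 2 + _; set q := A 0 0 * _ + _.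
set t := gram_top A => AuE pt rt tq.
have [qtp|qtp] := eqVneq (q ^+ 2 + (t - p) ^+ 2) 0.
  move/eqP: qtp; rewrite paddr_eq0 ?sqr_ge0// !sqrf_eq0 subr_eq0.
  move=> /andP[/eqP q0 /eqP tp].
  exists (\col_i (i == 0)%:R).
    by rewrite l2normE2 !mxE/= expr0n/= addr0 expr1n sqrtr1.
  by rewrite AuE !mxE/= -tp; congr Num.sqrt; ring.
have n0 : 0 < q ^+ 2 + (t - p) ^+ 2.
  by rewrite lt_neqAle eq_sym qtp addr_ge0 ?sqr_ge0.
pose c := Num.sqrt (q ^+ 2 + (t - p) ^+ 2).
have c0 : 0 < c by rewrite sqrtr_gt0.
have cE : c ^+ 2 = q ^+ 2 + (t - p) ^+ 2 by rewrite sqr_sqrtr// ltW.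
have c2 : c ^+ 2 != 0 by rewrite cE.
(* An eigenvector of the Gram matrix for the eigenvalue [t], normalized. *)
exists (\col_i ((if i == 0 then q else t - p) / c)).
  by rewrite l2normE2 !mxE/= !expr_div_n -mulrDl -cE divff// sqrtr1.
rewrite AuE !mxE/=; congr Num.sqrt.
apply/eqP; rewrite -subr_eq0.
have -> : p * (q / c) ^+ 2 + 2 * q * (q / c * ((t - p) / c))
    + r * ((t - p) / c) ^+ 2 - t
  = (p * q ^+ 2 + 2 * q * (q * (t - p)) + r * (t - p) ^+ 2 - t * c ^+ 2)
    / c ^+ 2.
  by field; rewrite gt_eqF.
rewrite cE mulf_eq0; apply/orP; left; apply/eqP.
have -> : p * q ^+ 2 + 2 * q * (q * (t - p)) + r * (t - p) ^+ 2
    - t * (q ^+ 2 + (t - p) ^+ 2)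
  = (t - p) * (q ^+ 2 - (t - p) * (t - r)) by ring.
by rewrite tq subrr mulr0.
Qed.

Lemma l2norm_mulmx_le (R : realType) (A : 'M[R]_2) (u : 'cV[R]_2) :
  l2norm (A *m u) <= opnorm A * l2norm u.
Proof. by rewrite opnorm2E; exact: l2norm_mulmx_le_gram. Qed.

Lemma opnorm_ge0 (R : realType) (A : 'M[R]_2) : 0 <= opnorm A.
Proof. by rewrite opnorm2E sqrtr_ge0. Qed.

Lemma opnormM (R : realType) (A B : 'M[R]_2) :
  opnorm (A *m B) <= opnorm A * opnorm B.
Proof.
apply: ge_sup.
  exists (l2norm (A *m B *m \col_i (i == 0)%:R)), (\col_i (i == 0)%:R) => //=.
  by rewrite l2normE2 !mxE/= expr0n/= addr0 expr1n sqrtr1.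
move=> _ [u u1 <-]; rewrite -mulmxA (le_trans (l2norm_mulmx_le _ _))//.
by rewrite ler_wpM2l ?opnorm_ge0// (le_trans (l2norm_mulmx_le _ _))// u1 mulr1.
Qed.

Lemma opnorm_ge_entry (R : realType) (A : 'M[R]_2) : `|A 0 0| <= opnorm A.
Proof.
rewrite opnorm2E -sqrtr_sqr ler_wsqrtr//.
by have [pt _ _] := gram_topP A; apply: le_trans pt; rewrite lerDl sqr_ge0.
Qed.

Lemma det_mx22 (R : comPzRingType) (A : 'M[R]_2) :
  \det A = A 0 0 * A 1 1 - A 0 1 * A 1 0.
Proof.
rewrite (expand_det_row _ 0) big_ord2 /cofactor !det_mx11 !mxE/=.
rewrite expr0 expr1 mul1r mulN1r mulrN.
by congr (_ * A _ _ - _ * A _ _); exact: val_inj.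
Qed.

(** Hadamard's inequality bounds the determinant by the product of the column lengths. *)
Lemma opnorm_ge1 (R : realType) (A : 'M[R]_2) : \det A = 1 -> 1 <= opnorm A.
Proof.
rewrite det_mx22 => detA; rewrite opnorm2E -[leLHS]sqrtr1 ler_wsqrtr//.
have [pt rt _] := gram_topP A; have t0 := gram_top_ge0 A.
have : 1 <= gram_top A * gram_top A.
  apply: (@le_trans _ _ ((A 0 0 ^+ 2 + A 1 0 ^+ 2) * (A 0 1 ^+ 2 + A 1 1 ^+ 2))).
    rewrite -[leLHS](expr1n _ 2) -detA -subr_ge0.
    have -> : (A 0 0 ^+ 2 + A 1 0 ^+ 2) * (A 0 1 ^+ 2 + A 1 1 ^+ 2)
      - (A 0 0 * A 1 1 - A 0 1 * A 1 0) ^+ 2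
      = (A 0 0 * A 0 1 + A 1 0 * A 1 1) ^+ 2 by ring.
    exact: sqr_ge0.
  by apply: ler_pM; rewrite ?addr_ge0 ?sqr_ge0.
nra.
Qed.

Lemma measurable_opnorm (d : measure_display) (T : measurableType d)
    (R : realType) (D : set T) (M : T -> 'M[R]_2) : measurable D ->
  (forall i j, measurable_fun D (fun x => M x i j)) ->
  measurable_fun D (fun x => opnorm (M x)).
Proof.
move=> mD mM.
have msqrt (f : T -> R) : measurable_fun D f ->
    measurable_fun D (fun x => Num.sqrt (f x)).
  move=> mf; apply: (@measurableT_comp _ _ _ _ _ _ (@Num.sqrt R)) => //.
  by apply: continuous_measurable_fun; exact: sqrt_continuous.
under eq_fun do rewrite opnorm2E /gram_top /gram_disc.
apply: (msqrt); apply: measurable_funM => //.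
by repeat first [apply: measurable_funD | apply: measurable_funN
  | apply: measurable_funX | apply: measurable_funM | apply: (msqrt)
  | exact: mM | exact: measurable_cst].
Qed.

(** * Invariance of Lebesgue measure under the expanding map *)

(** The rescaled pushforward of Lebesgue measure under an affine map agrees with
    Lebesgue measure on intervals, hence everywhere. *)
Lemma ge0_integral_affine (R : realType) (c b : R)
    (D : set (measurableTypeR R)) (f : measurableTypeR R -> \bar R) :
  0 < c -> measurable D -> measurable_fun D f -> (forall x, 0 <= f x)%E ->
  (\int[lebesgue_measure]_(x in (fun x => c * x + b)%R @^-1` D) f (c * x + b)%R
    = c^-1%:E * \int[lebesgue_measure]_(x in D) f x)%E.
Proof.
move=> c0 mD mf f0; pose g (x : measurableTypeR R) : measurableTypeR R := c * x + b.
have mg : measurable_fun setT g.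
  by apply: measurable_funD; [exact: mulrl_measurable|exact: measurable_cst].
pose gM := isMeasurableFun.Build _ _ _ _ _ mg.
pose gm : {mfun measurableTypeR R >-> measurableTypeR R} := HB.pack g gM.
have c0' : 0 <= c by exact: ltW.
have muE A : measurable A ->
    lebesgue_measure A = mscale (NngNum c0') (pushforward lebesgue_measure gm) A.
  apply: lebesgue_measure_unique => _ [[a a'] _ <-].
  change (lebesgue_measure (`]a, a']%classic : set (measurableTypeR R))
    = (c%:E * lebesgue_measure (g @^-1` `]a, a']%classic))%E).
  have gE : g @^-1` `]a, a']%classic = `](a - b) / c, (a' - b) / c]%classic.
    apply/seteqP; split => x /=; rewrite /g !in_itv/= ltr_pdivrMr// ler_pdivlMr//;
      rewrite ![_ * c]mulrC; lra.
  rewrite gE !lebesgue_measure_itv/= !lte_fin ltr_pM2r ?invr_gt0// ltrD2r.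
  case: ltP => _; last by rewrite mule0.
  by rewrite -!EFinB -EFinM; congr EFin; field; rewrite gt_eqF.
have -> : (\int[lebesgue_measure]_(x in D) f x =
    c%:E * \int[pushforward lebesgue_measure gm]_(x in D) f x)%E.
  rewrite -(@ge0_integral_mscale _ _ _ (pushforward lebesgue_measure gm) _ mD
    (NngNum c0') f mf)//.
  by apply: eq_measure_integral => A mA _; exact: muE.
rewrite ge0_integral_pushforward//.
by rewrite muleA -EFinM mulVf ?gt_eqF// mul1e.
Qed.

(** The circle is the disjoint union of the [k] preimages of itself under the
    inverse branches; the affine change of variables gives each the same share
    of the integral. *)
Lemma ge0_integral_expanding_map (R : realType) (k : nat) (f : R -> \bar R) :
  (0 < k)%N -> measurable_fun (@circle R : set (measurableTypeR R)) f ->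
  (forall x, 0 <= f x)%E ->
  (\int[lebesgue_measure]_(x in @circle R) f (expanding_map k x)
    = \int[lebesgue_measure]_(x in @circle R) f x)%E.
Proof.
move=> k0 mf f0; have k0' : (0 : R) < k%:R by rewrite ltr0n.
pose F (i : 'I_k) : set (measurableTypeR R) :=
  (fun x => k%:R * x + - i%:R) @^-1` @circle R.
have mF i : measurable (F i).
  rewrite -[F i]setTI; apply: (@measurable_funD _ _ R setT) => //.
  exact: measurable_circle.
have FE : (@circle R : set (measurableTypeR R))
    = \big[setU/set0]_(i <- index_enum 'I_k) F i.
  apply/seteqP; split => x.
    move=> cx; have xk := cylinder_lt 1 k0 cx.
    rewrite expn1 in xk; rewrite -bigcup_seq; exists (Ordinal xk).
      by rewrite /= mem_index_enum.
    rewrite /F/= -(expr1 k%:R) -iter_expanding_map_cylinder//.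
    exact: circle_expanding_map.
  rewrite -bigcup_seq => -[i _]; rewrite /F/= !circleE => /andP[x0 x1].
  have ik : (i%:R : R) + 1 <= k%:R by rewrite natr1 ler_nat.
  have i0 : (0 : R) <= i%:R by [].
  apply/andP; split.
    rewrite -(pmulr_rge0 _ k0'); lra.
  rewrite -(ltr_pM2l k0') mulr1; lra.
have TF i x : F i x -> expanding_map k x = k%:R * x + - i%:R.
  rewrite /F/= circleE /expanding_map => /andP[x0 x1].
  rewrite (_ : Num.floor _ = i%:Z)//; apply: floor_def.
  rewrite intrD1 -pmulrn; apply/andP; split; lra.
have tF : trivIset [set` index_enum 'I_k] F.
  move=> i j _ _ [x [Fi Fj]]; apply: val_inj.
  have := TF i x Fi; rewrite (TF j x Fj) => /addrI /oppr_inj/eqP.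
  by rewrite eqr_nat => /eqP.
have mfT : measurable_fun (@circle R : set (measurableTypeR R))
    (fun x => f (expanding_map k x)).
  apply: measurable_comp mf _; first exact: measurable_circle.
    by move=> _ [x cx <-]; exact: (@circle_expanding_map R k 1).
  by apply: measurable_funS (@measurable_expanding_map R k 1).
rewrite [in LHS]FE ge0_integral_bigsetU ?index_enum_uniq -?FE//.
rewrite (eq_bigr (fun=> (k%:R^-1)%:E *
    \int[lebesgue_measure]_(x in @circle R) f x)%E); last first.
  move=> i _; rewrite -(@ge0_integral_affine R k%:R (- i%:R) (@circle R))//.
    by apply: eq_integral => x; rewrite inE => Fx; rewrite (TF i).
  exact: measurable_circle.
rewrite -ge0_sume_distrl; last by move=> i _; rewrite lee_fin invr_ge0 ltW.
rewrite sumEFin sumr_const card_ord -[(_ *+ _)%R]mulr_natl divff ?gt_eqF//.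
by rewrite mul1e.
Qed.

Lemma ge0_integral_iter_expanding_map (R : realType) (k j : nat)
    (f : R -> \bar R) :
  (0 < k)%N -> measurable_fun (@circle R : set (measurableTypeR R)) f ->
  (forall x, 0 <= f x)%E ->
  (\int[lebesgue_measure]_(x in @circle R) f (iter j (expanding_map k) x)
    = \int[lebesgue_measure]_(x in @circle R) f x)%E.
Proof.
move=> k0 mf f0; elim: j => [//|j <-].
under eq_integral do rewrite iterSr.
apply: (@ge0_integral_expanding_map R k (fun x => f (iter j (expanding_map k) x))) => //.
apply: measurable_comp mf _; first exact: measurable_circle.
  by move=> _ [x cx <-]; exact: circle_expanding_map.
by apply: measurable_funS (@measurable_expanding_map R k j).
Qed.

(** * Fekete's lemma *)

(** Fekete's lemma: the limit is the infimum of the quotients.  Dividing [n] by a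
    fixed [N] whose quotient is nearly minimal bounds the others from above. *)
Lemma subadditive_cvg (R : realType) (a : nat -> R) :
  (forall n, 0 <= a n) -> (forall m n, a (m + n)%N <= a m + a n) ->
  cvgn (fun n => n%:R^-1 * a n).
Proof.
move=> a0 suba; pose S := [set n%:R^-1 * a n | n in [set n | (0 < n)%N]].
have S0 : S (1%:R^-1 * a 1%N) by exists 1%N.
have lbS : lbound S 0 by move=> _ [n _ <-]; rewrite mulr_ge0// invr_ge0.
have hiS : has_inf S by split; [exists (1%:R^-1 * a 1%N)|exists 0].
have a_mul q n : a (q * n)%N <= a 0%N + q%:R * a n.
  elim: q => [|q IHq]; first by rewrite mul0r addr0.
  rewrite mulSn -natr1 mulrDl mul1r (le_trans (suba _ _))//; lra.
apply/cvg_ex; exists (inf S); apply/cvgrPdist_le => e e0.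
have [_ [N N0 <-] aN] := @inf_adherent _ S (e / 2) (divr_gt0 e0 (ltr0n _ 2)) hiS.
have N0' : (0 : R) < N%:R by rewrite ltr0n.
(* A bound for what the remainder of the division by [N] contributes. *)
pose B := 2 * a 0%N + N%:R * a 1%N.
have B0 : 0 <= B by rewrite addr_ge0// mulr_ge0.
near=> n.
have n0 : (0 < n)%N by near: n; exists 1%N.
have n0' : (0 : R) < n%:R by rewrite ltr0n.
have lb : inf S <= n%:R^-1 * a n by apply: ge_inf; [exists 0|exists n].
have nB : B * (2 / e) <= n%:R by near: n; exact: nbhs_infty_ger.
have aB : a n <= n%:R * (N%:R^-1 * a N) + B.
  rewrite {1}(divn_eq n N) (le_trans (suba _ _))//.
  have := a_mul (n %/ N)%N N; have := a_mul (n %% N)%N 1%N; rewrite muln1.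
  have : (n %% N)%:R * a 1%N <= N%:R * a 1%N.
    by rewrite ler_wpM2r// ler_nat ltnW// ltn_mod.
  have : (n %/ N)%:R * a N <= n%:R * (N%:R^-1 * a N).
    rewrite mulrA ler_wpM2r// ler_pdivlMr// -natrM ler_nat.
    exact: leq_divM.
  rewrite /B; lra.
have up : n%:R^-1 * a n <= N%:R^-1 * a N + e / 2.
  rewrite mulrC ler_pdivrMr// (le_trans aB)//.
  rewrite mulrDl [_ * n%:R]mulrC lerD2l.
  rewrite mulrA ler_pdivrMr// in nB.
  rewrite [leRHS]mulrC mulrA ler_pdivlMr//; lra.
rewrite distrC ger0_norm ?subr_ge0//; lra.
Unshelve. all: by end_near. Qed.

(** * The Schroedinger cocycle *)

Lemma cocycleD (R : realType) (T v : R -> R) (lambda E : R) (m n : nat) (x : R) :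
  cocycle T v lambda E (m + n) x
    = cocycle T v lambda E m (iter n T x) *m cocycle T v lambda E n x.
Proof.
elim: m => [|m IHm]; first by rewrite mul1mx.
by rewrite addSn /= IHm mulmxA iterD.
Qed.

Lemma det_cocycle (R : realType) (T v : R -> R) (lambda E : R) (n : nat) (x : R) :
  \det (cocycle T v lambda E n x) = 1.
Proof.
elim: n => [|n IHn] /=; first by rewrite det1.
by rewrite det_mulmx IHn det_mx22 !mxE/=; ring.
Qed.

Lemma measurable_cocycle (R : realType) (k : nat) (v : R -> R) (lambda E : R)
    (n : nat) (i j : 'I_2) :
  measurable_fun (@circle R : set (measurableTypeR R)) v ->
  measurable_fun (@circle R : set (measurableTypeR R))
    (fun x => cocycle (expanding_map k) v lambda E n x i j).
Proof.
move=> mv; elim: n i j => [|n IHn] i j /=; first exact: measurable_cst.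
under eq_fun do rewrite mxE big_ord2.
apply: measurable_funD; apply: measurable_funM; try exact: IHn;
  under eq_fun do rewrite mxE; case: i => [[|[|[]]]] //= _;
  try exact: measurable_cst.
apply: measurable_funD; first exact: measurable_cst.
apply: measurable_funN; apply: measurable_funM; first exact: measurable_cst.
exact: measurable_comp_iter.
Qed.

Definition ln_cocycle (R : realType) (k : nat) (v : R -> R) (lambda E : R)
    (n : nat) (x : R) : R :=
  ln (opnorm (cocycle (expanding_map k) v lambda E n x)).

Lemma opnorm_transfer_le (R : realType) (v : R -> R) (lambda E x b : R) :
  `|E - lambda * v x| <= b ->
  opnorm (transfer v lambda E x) <= Num.sqrt (b ^+ 2 + 2).
Proof.
move=> tb; rewrite opnorm2E ler_wsqrtr//.
rewrite /gram_top /gram_disc !mxE/=.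
set t := E - lambda * v x in tb *.
have t2 : t ^+ 2 <= b ^+ 2.
  by rewrite -[t ^+ 2]real_normK ?num_real// lerXn2r ?nnegrE// (le_trans _ tb).
set s := Num.sqrt _.
suff : s <= t ^+ 2 + 2 by lra.
have t20 : 0 <= t ^+ 2 by exact: sqr_ge0.
rewrite -[leRHS]ger0_norm ?addr_ge0// -sqrtr_sqr ler_wsqrtr//.
by nra.
Qed.

(** The cocycle has determinant one. *)
Lemma ln_cocycle_ge0 (R : realType) (k : nat) (v : R -> R) (lambda E : R)
    (n : nat) (x : R) : 0 <= ln_cocycle k v lambda E n x.
Proof. by rewrite ln_ge0// opnorm_ge1// det_cocycle. Qed.

Lemma opnorm_cocycle_gt0 (R : realType) (T v : R -> R) (lambda E : R)
    (n : nat) (x : R) : 0 < opnorm (cocycle T v lambda E n x).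
Proof. by rewrite (lt_le_trans ltr01)// opnorm_ge1// det_cocycle. Qed.

Lemma ln_cocycleD (R : realType) (k : nat) (v : R -> R) (lambda E : R)
    (m n : nat) (x : R) :
  ln_cocycle k v lambda E (m + n) x
    <= ln_cocycle k v lambda E m (iter n (expanding_map k) x)
       + ln_cocycle k v lambda E n x.
Proof.
rewrite /ln_cocycle -lnM ?posrE ?opnorm_cocycle_gt0//.
rewrite ler_ln ?posrE ?mulr_gt0 ?opnorm_cocycle_gt0//.
by rewrite cocycleD opnormM.
Qed.

Lemma measurable_ln_cocycle (R : realType) (k : nat) (v : R -> R)
    (lambda E : R) (n : nat) :
  measurable_fun (@circle R : set (measurableTypeR R)) v ->
  measurable_fun (@circle R : set (measurableTypeR R)) (ln_cocycle k v lambda E n).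
Proof.
move=> mv; apply: (measurableT_comp (@measurable_ln R)).
apply: measurable_opnorm; first exact: measurable_circle.
by move=> i j; exact: measurable_cocycle.
Qed.

Lemma ln_cocycle_bounded (R : realType) (k : nat) (v : R -> R) (lambda E : R)
    (n : nat) : [bounded v x | x in @circle R] ->
  exists b, forall x, circle x -> ln_cocycle k v lambda E n x <= b.
Proof.
move=> [M0 [_ vM0]]; pose M := M0 + 1.
have vM x : circle x -> `|v x| <= M by apply: vM0; rewrite ltrDl.
have vb x : circle x -> `|E - lambda * v x| <= `|E| + `|lambda| * M.
  move=> cx; rewrite (le_trans (ler_normB _ _))// lerD2l normrM ler_wpM2l//.
  exact: vM.
exists (n%:R * ln (Num.sqrt ((`|E| + `|lambda| * M) ^+ 2 + 2))) => x cx.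
elim: n => [|n IHn].
  rewrite mul0r /ln_cocycle/= opnorm2E /gram_top /gram_disc !mxE/=.
  rewrite (_ : _ / _ = 1) ?sqrtr1 ?ln1//.
  rewrite !(expr0n, expr1n)/= !(addr0, add0r, mulr0, mul0r, subrr) expr0n/=.
  by rewrite mulr0 addr0 sqrtr0 addr0; field.
rewrite (le_trans (ln_cocycleD k v lambda E 1 n x))//.
rewrite -natr1 mulrDl mul1r [leRHS]addrC lerD//.
rewrite /ln_cocycle/= mulmx1 ler_ln ?posrE.
- exact/opnorm_transfer_le/vb/circle_expanding_map.
- by have := opnorm_cocycle_gt0 (expanding_map k) v lambda E 1
    (iter n (expanding_map k) x); rewrite /= mulmx1.
- by rewrite sqrtr_gt0 ltr_wpDl ?sqr_ge0.
Qed.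

(** * The mean of the logarithm of the cocycle *)

Lemma lebesgue_measure_circle (R : realType) :
  lebesgue_measure (@circle R : set (measurableTypeR R)) = 1%E.
Proof.
by rewrite /circle lebesgue_measure_itv/= lte_fin ltr01 -EFinB subr0.
Qed.

Lemma le_circle_integralD (R : realType) (f g h : R -> R) :
  measurable_fun (@circle R : set (measurableTypeR R)) f ->
  measurable_fun (@circle R : set (measurableTypeR R)) g ->
  measurable_fun (@circle R : set (measurableTypeR R)) h ->
  (forall x, 0 <= f x) -> (forall x, 0 <= g x) -> (forall x, 0 <= h x) ->
  (forall x, circle x -> f x <= g x + h x) ->
  (\int[lebesgue_measure]_(x in @circle R) (f x)%:E <=
    \int[lebesgue_measure]_(x in @circle R) (g x)%:E +
    \int[lebesgue_measure]_(x in @circle R) (h x)%:E)%E.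
Proof.
move=> /measurable_EFinP mf /measurable_EFinP mg /measurable_EFinP mh f0 g0 h0.
move=> le_f; rewrite -ge0_integralD//; first last.
- by move=> x _; rewrite lee_fin.
- by move=> x _; rewrite lee_fin.
- exact: measurable_circle.
apply: ge0_le_integral => //.
- exact: measurable_circle.
- by move=> x _; rewrite lee_fin.
- exact: emeasurable_funD.
Qed.

Definition mean_ln_cocycle (R : realType) (k : nat) (v : R -> R)
    (lambda E : R) (n : nat) : R :=
  \int[lebesgue_measure]_(x in @circle R) ln_cocycle k v lambda E n x.

Lemma EFin_mean_ln_cocycle (R : realType) (k : nat) (v : R -> R)
    (lambda E : R) (n : nat) :
  measurable_fun (@circle R : set (measurableTypeR R)) v ->
  [bounded v x | x in @circle R] ->
  (\int[lebesgue_measure]_(x in @circle R) (ln_cocycle k v lambda E n x)%:E)%E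
    = (mean_ln_cocycle k v lambda E n)%:E.
Proof.
move=> mv bv; rewrite /mean_ln_cocycle /Rintegral fineK// ge0_fin_numE; last first.
  by apply: integral_ge0 => x _; rewrite lee_fin ln_cocycle_ge0.
have [b leb] := ln_cocycle_bounded k lambda E n bv.
apply: (@le_lt_trans _ _ (\int[lebesgue_measure]_(x in @circle R) b%:E)%E).
  apply: ge0_le_integral => //.
  - exact: measurable_circle.
  - by move=> x _; rewrite lee_fin ln_cocycle_ge0.
  - by apply/measurable_EFinP; exact: measurable_ln_cocycle.
rewrite integral_cst; [|exact: measurable_circle].
by rewrite [X in (_ * X)%E](lebesgue_measure_circle R) mule1 ltry.
Qed.

Lemma mean_ln_cocycle_ge0 (R : realType) (k : nat) (v : R -> R)
    (lambda E : R) (n : nat) : 0 <= mean_ln_cocycle k v lambda E n.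
Proof. by apply: Rintegral_ge0 => x _; exact: ln_cocycle_ge0. Qed.

Lemma mean_ln_cocycleD (R : realType) (k : nat) (v : R -> R) (lambda E : R)
    (m n : nat) : (0 < k)%N ->
  measurable_fun (@circle R : set (measurableTypeR R)) v ->
  [bounded v x | x in @circle R] ->
  mean_ln_cocycle k v lambda E (m + n)
    <= mean_ln_cocycle k v lambda E m + mean_ln_cocycle k v lambda E n.
Proof.
move=> k0 mv bv; have meanE i := EFin_mean_ln_cocycle k lambda E i mv bv.
have mL i := @measurable_ln_cocycle R k v lambda E i mv.
have fin_le (a b c : R) (x y z : \bar R) : x = a%:E -> y = b%:E -> z = c%:E ->
    (x <= y + z)%E -> a <= b + c.
  by move=> -> -> ->; rewrite -EFinD lee_fin.
have iterE := @ge0_integral_iter_expanding_map R k n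
  (fun x => (ln_cocycle k v lambda E m x)%:E) k0.
apply: (fin_le _ _ _ _ _ _ (meanE (m + n)%N) (etrans (iterE _ _) (meanE m))
  (meanE n)).
- by apply/measurable_EFinP.
- by move=> x; rewrite lee_fin ln_cocycle_ge0.
have mLT : measurable_fun (@circle R : set (measurableTypeR R))
    (fun x => ln_cocycle k v lambda E m (iter n (expanding_map k) x)).
  by exact: measurable_comp_iter.
apply: le_circle_integralD.
- exact: mL.
- exact: mLT.
- exact: mL.
- by move=> x; exact: ln_cocycle_ge0.
- by move=> x; exact: ln_cocycle_ge0.
- by move=> x; exact: ln_cocycle_ge0.
- by move=> x _; exact: ln_cocycleD.
Qed.

(** The product telescopes: the first column of the cocycle holds two successive
    terms of the three term recurrence. *)
Lemma cocycle00_riccati (R : realType) (k : nat) (v : R -> R) (lambda E : R)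
    (n : nat) (x : R) :
  let f y := E - lambda * v y in nonsingular k f n x ->
  cocycle (expanding_map k) v lambda E n x 0 0
    = \prod_(j < n) riccati k f j x.
Proof.
move=> f; set A := cocycle _ v lambda E.
suff step m : nonsingular k f m x ->
    A m.+1 x 0 0 = riccati k f m x * A m x 0 0.
  elim: n => [|n IHn] nx; first by rewrite big_ord0 !mxE.
  have nx' : nonsingular k f n x by move=> i /ltnW; exact: nx.
  by rewrite big_ord_recr/= -(IHn nx') step// mulrC.
have step00 i : A i.+1 x 0 0
    = f (iter i (expanding_map k) x) * A i x 0 0 - A i x 1 0.
  by rewrite /A /= mxE big_ord2 !mxE/= mulN1r.
have step10 i : A i.+1 x 1 0 = A i x 0 0.
  by rewrite /A /= mxE big_ord2 !mxE/= mul1r mul0r addr0.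
elim: m => [|m IHm] nx; first by rewrite step00 /A/= !mxE/= subr0.
have nx' : nonsingular k f m x by move=> i /ltnW; exact: nx.
have ricE : riccati k f m.+1 x
    = f (iter m.+1 (expanding_map k) x) - (riccati k f m x)^-1 by [].
have AmE : A m x 0 0 = (riccati k f m x)^-1 * A m.+1 x 0 0.
  by rewrite (IHm nx') mulKf// nx.
by rewrite step00 step10 AmE ricE [RHS]mulrBl.
Qed.

(** Bounds the negative part of a logarithm by a sum of indicators, one for each
    unit step. *)
Lemma le_sum_lt_nat (R : realType) (s : R) (M : nat) : s <= M%:R ->
  s <= \sum_(i < M) (i%:R < s)%R%:R.
Proof.
elim: M => [|M IHM]; first by rewrite big_ord0.
have [sM _|Ms sM] := leP s M%:R.
  by rewrite big_ord_recr/= (le_trans (IHM sM))// lerDl.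
rewrite (le_trans sM)// (eq_bigr (fun=> 1)) ?sumr_const ?card_ord//.
move=> i _; rewrite (le_lt_trans _ Ms)// ler_nat.
by rewrite -ltnS ltn_ord.
Qed.

Lemma ln_prod (R : realType) (n : nat) (F : 'I_n -> R) :
  (forall i, 0 < F i) -> ln (\prod_(i < n) F i) = \sum_(i < n) ln (F i).
Proof.
elim: n F => [|n IHn] F F0; first by rewrite !big_ord0 ln1.
rewrite !big_ord_recr/= lnM ?posrE ?IHn//.
by apply: prodr_gt0.
Qed.

(** The weights in the truncation of the negative part of [ln (|m_j| / lambda)]
    at height [M].  Up to [M], it is counted in unit steps; where
    [|m_j| < lambda * expR (- M)], the weight [n * l], with [l := ln lambda], is
    all that the trivial bound [0 <= ln_cocycle] falls short by. *)
Definition penalty (R : realType) (l : R) (n M i : nat) : R :=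
  if (i < M)%N then 1 else n%:R * l.

(** If no term of the Riccati sequence is below [lambda * expR (- M)], the sequence
    is nonsingular and the norm is at least the product of its terms;
    otherwise the penalty alone exceeds the left-hand side.  Truncating keeps the
    integrand finite and avoids discarding the null set of singular points. *)
Lemma ln_cocycle_ge (R : realType) (k : nat) (v : R -> R) (lambda E : R)
    (n M : nat) (x : R) : let f y := E - lambda * v y in
  0 < lambda -> 0 <= ln lambda -> circle x ->
  n%:R * ln lambda <= ln_cocycle k v lambda E n x +
    \sum_(j < n) \sum_(i < M.+1) penalty (ln lambda) n M i
      * \1_(small_riccati k f j (lambda * expR (- i%:R))) x.
Proof.
move=> f l0 lnl0 cx.
pose S (j i : nat) := small_riccati k f j (lambda * expR (- i%:R)).
have p0 i : 0 <= penalty (ln lambda) n M i.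
  by rewrite /penalty; case: ifP => // _; rewrite mulr_ge0.
have t0 j i : 0 <= penalty (ln lambda) n M i * \1_(S j i) x by rewrite mulr_ge0.
have s0 j : 0 <= \sum_(i < M.+1) penalty (ln lambda) n M i * \1_(S j i) x.
  by apply: sumr_ge0.
have [[j Sj]|nS] := pselect (exists j : 'I_n, S j M x).
  rewrite -[leLHS]add0r lerD ?ln_cocycle_ge0//.
  rewrite (bigD1 j)//= big_ord_recr/= /penalty ltnn -/(penalty _ _ _ _).
  rewrite indicE mem_set// mulr1 addrAC lerDr addr_ge0//.
    by apply: sumr_ge0 => i _; exact: (t0 j i).
  by apply: sumr_ge0 => i _; exact: s0.
have nx : forall j, (j <= n)%N -> nonsingular k f j x.
  elim=> [//|j IHj] jn i; rewrite ltnS leq_eqVlt => /predU1P[->|]; last first.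
    by apply: IHj; exact: ltnW.
  apply: contra_notN nS => /eqP mj; exists (Ordinal jn); split => //=.
    by apply: IHj; exact: ltnW.
  by rewrite mj normr0 mulr_gt0 ?expR_gt0.
have mge (j : 'I_n) : lambda * expR (- M%:R) <= `|riccati k f j x|.
  rewrite leNgt; apply: contra_notN nS => mj; exists j; split => //.
  by apply: nx; exact: ltnW.
have m0 (j : 'I_n) : 0 < `|riccati k f j x|.
  by rewrite (lt_le_trans _ (mge j))// mulr_gt0 ?expR_gt0.
have : \sum_(j < n) ln `|riccati k f j x| <= ln_cocycle k v lambda E n x.
  rewrite -ln_prod// -normr_prod -(cocycle00_riccati (nx n (leqnn n))).
  rewrite ler_ln ?posrE ?opnorm_cocycle_gt0 ?opnorm_ge_entry//.
  by rewrite (cocycle00_riccati (nx n (leqnn n))) normr_prod prodr_gt0.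
move=> le_ln; rewrite -lerBlDr (le_trans _ le_ln)// lerBlDr -big_split/=.
rewrite (_ : n%:R * ln lambda = \sum_(j < n) ln lambda); last first.
  by rewrite sumr_const card_ord mulr_natl.
apply: ler_sum => j _; rewrite -lerBlDl.
have sM : ln lambda - ln `|riccati k f j x| <= M%:R.
  rewrite lerBlDl -lerBlDr -[- M%:R](@expRK R) -lnM ?posrE ?expR_gt0//.
  by rewrite ler_ln ?posrE// mulr_gt0 ?expR_gt0.
apply: le_trans (le_sum_lt_nat sM) _.
rewrite [leRHS]big_ord_recr/= ler_wpDr ?mulr_ge0//.
apply: ler_sum => i _; rewrite /penalty ltn_ord mul1r indicE.
case: (ltP i%:R _) => [ilt|//].
rewrite mem_set//; split => //; first by apply: nx; exact: ltnW.
rewrite -ltr_ln ?posrE ?mulr_gt0 ?expR_gt0// lnM ?posrE ?expR_gt0// expRK; lra.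
Qed.

(** * The lower bound on the mean *)

Lemma integral_sum_indic_le (R : realType) (I : finType) (w b : I -> R)
    (S : I -> set (measurableTypeR R)) :
  (forall i, 0 <= w i) -> (forall i, measurable (S i)) ->
  (forall i, S i `<=` @circle R) ->
  (forall i, (lebesgue_measure (S i) <= (b i)%:E)%E) ->
  (\int[lebesgue_measure]_(x in @circle R) (\sum_i w i * \1_(S i) x)%:E
    <= (\sum_i w i * b i)%:E)%E.
Proof.
move=> w0 mS Sc Sb; have mc := @measurable_circle R.
have m1 i : measurable_fun (@circle R : set (measurableTypeR R))
    (fun x => (\1_(S i) x)%:E : \bar R).
  by apply/measurable_EFinP; exact: measurable_indic.
under eq_integral do rewrite -sumEFin.
under eq_integral do under eq_bigr do rewrite EFinM.
rewrite ge0_integral_sum//; last 2 first.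
- by move=> i; apply: emeasurable_funM => //; exact: measurable_cst.
- by move=> i x _; rewrite mule_ge0// lee_fin.
rewrite -sumEFin; apply: lee_sum => i _.
rewrite ge0_integralZl_EFin//.
rewrite integral_indic//.
rewrite EFinM lee_wpmul2l ?lee_fin//.
rewrite setIidl; [exact: Sb|exact: Sc].
Qed.

Lemma sum_expr_le (R : realType) (q : R) (M : nat) : 0 <= q -> q < 1 ->
  \sum_(i < M) q ^+ i <= (1 - q)^-1.
Proof.
move=> q0 q1; have q1' : 0 < 1 - q by rewrite subr_gt0.
rewrite -[leRHS]mul1r ler_pdivlMr// -subr_ge0.
have := subrX1 q M; rewrite mulrC => qE.
have -> : 1 - (\sum_(i < M) q ^+ i) * (1 - q) = q ^+ M by move: qE; lra.
exact: exprn_ge0.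
Qed.

Lemma le_geometric_limit (R : realType) (x y b q : R) : 0 <= q -> q < 1 ->
  (forall M, x <= y + b * q ^+ M) -> x <= y.
Proof.
move=> q0 q1 le_xy; apply/ler_addgt0Pr => e e0.
have : (fun M => b * q ^+ M) @ \oo --> b * 0.
  by apply: cvgM; [exact: cvg_cst|apply: cvg_expr]; rewrite ger0_norm.
rewrite mulr0 => /cvgrPdist_le/(_ _ e0)[M _ /(_ M (leqnn M))]/=.
rewrite sub0r normrN => bq; rewrite (le_trans (le_xy M))// lerD2l.
exact: le_trans (ler_norm _) bq.
Qed.

(** The measure of the set [|m_j| < lambda * expR (- i)] decays like the [i]th power
    of this number. *)
Definition decay_rate (R : realType) (alpha : R) : R := expR (- alpha^-1).

(** The sum over [i] of the bounds of [lebesgue_measure_small_riccati] for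
    [e := lambda * expR (- i)] and [h := lambda * H]: the factors [lambda] cancel,
    which is why the defect depends on the potential alone. *)
Definition lyapunov_defect (R : realType) (H alpha : R) : R :=
  4 * (2 / H) `^ alpha^-1 / (1 - decay_rate alpha).

(** For [ln lambda >= 0], the pointwise bound [ln_cocycle_ge] is integrated and the
    truncation is removed by letting [M] tend to infinity; the truncation term
    is quadratic in [n], which is harmless since [n] is fixed.  For
    [ln lambda < 0] the left-hand side is nonpositive. *)
Lemma mean_ln_cocycle_ge (R : realType) (k : nat) (v : R -> R) (H alpha : R)
    (lambda E : R) (n : nat) : (2 <= k)%N -> 0 < alpha -> 0 < H ->
  (forall x y, circle x -> circle y -> H * `|x - y| `^ alpha <= `|v x - v y|) ->
  measurable_fun (@circle R : set (measurableTypeR R)) v ->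
  [bounded v x | x in @circle R] -> monotone_on_circle v -> 0 < lambda ->
  n%:R * (ln lambda - lyapunov_defect H alpha) <= mean_ln_cocycle k v lambda E n.
Proof.
move=> k2 al0 H0 antiv mv bv monv l0.
set q := decay_rate alpha; set c := 4 * (2 / H) `^ alpha^-1.
have q0 : 0 <= q by exact: expR_ge0.
have q1 : q < 1 by rewrite /q /decay_rate expR_lt1 oppr_lt0 invr_gt0.
have c0 : 0 <= c by rewrite mulr_ge0 ?powR_ge0.
have C0 : 0 <= lyapunov_defect H alpha by rewrite divr_ge0// subr_ge0 ltW.
have [lnl0|lnl0] := ltP (ln lambda) 0.
  rewrite (le_trans _ (mean_ln_cocycle_ge0 _ _ _ _ _))// mulr_ge0_le0//; lra.
pose f y := E - lambda * v y.
have mf : measurable_fun (@circle R : set (measurableTypeR R)) f.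
  apply: measurable_funB; first exact: measurable_cst.
  by apply: measurable_funM => //; exact: measurable_cst.
have antif x y : circle x -> circle y ->
    lambda * H * `|x - y| `^ alpha <= `|f x - f y|.
  move=> cx cy; rewrite -mulrA.
  have -> : f x - f y = lambda * (v y - v x) by rewrite /f; ring.
  by rewrite normrM gtr0_norm// ler_pM2l// [leRHS]distrC antiv.
have monf : monotone_on_circle f.
  case: monv => monv; [right|left] => x y cx cy xy;
  by rewrite /f lerD2l lerN2 ler_pM2l// monv.
pose S (M : nat) (p : 'I_n * 'I_M.+1) :=
  small_riccati k f p.1 (lambda * expR (- p.2%:R)).
have Sb M p : (lebesgue_measure (S M p : set (measurableTypeR R))
    <= (c * q ^+ p.2)%:E)%E.
  apply: le_trans (lebesgue_measure_small_riccati _ k2 (mulr_gt0 l0 H0) al0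
    _ mf antif monf) _; first by rewrite mulr_ge0 ?expR_ge0 ?ltW.
  rewrite lee_fin /c -[leRHS]mulrA ler_pM2l// le_eqVlt; apply/orP; left; apply/eqP.
  have -> : 2 * (lambda * expR (- p.2%:R)) / (lambda * H)
      = 2 / H * expR (- p.2%:R) by field; rewrite !gt_eqF.
  rewrite powRM ?expR_ge0//; last by rewrite divr_ge0// ltW.
  congr (_ * _); rewrite -expRM /q /decay_rate -expRM_natl.
  by congr expR; ring.
apply: (@le_geometric_limit _ _ _ (n%:R * (n%:R * ln lambda) * c) q) => // M.
pose w (p : 'I_n * 'I_M.+1) := penalty (ln lambda) n M p.2.
have w0 p : 0 <= w p by rewrite /w /penalty; case: ifP => // _; rewrite mulr_ge0.
have mS p : measurable (S M p : set (measurableTypeR R)).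
  exact: measurable_small_riccati.
have : n%:R * ln lambda <= mean_ln_cocycle k v lambda E n
    + \sum_p w p * (c * q ^+ p.2).
  rewrite -lee_fin EFinD -EFin_mean_ln_cocycle//.
  apply: le_trans (leeD2l _ (integral_sum_indic_le w0 mS _ (Sb M))); last first.
    by move=> p x [].
  rewrite -[leLHS]mule1 -[X in (_ * X)%E](lebesgue_measure_circle R).
  rewrite -integral_cst; last exact: measurable_circle.
  apply: (@le_circle_integralD R (fun=> n%:R * ln lambda)).
  - exact: measurable_cst.
  - exact: measurable_ln_cocycle.
  - apply: measurable_sum => p; apply: measurable_funM.
      exact: measurable_cst.
    exact: measurable_indic.
  - by move=> _; rewrite mulr_ge0.
  - by move=> x; exact: ln_cocycle_ge0.
  - by move=> x; apply: sumr_ge0 => p _; rewrite mulr_ge0.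
  move=> x cx; have := ln_cocycle_ge k v E n M l0 lnl0 cx.
  rewrite (pair_bigA _ (fun (j : 'I_n) (i : 'I_M.+1) => penalty (ln lambda) n M i
    * \1_(small_riccati k f j (lambda * expR (- i%:R))) x)).
  exact.
have -> : \sum_p w p * (c * q ^+ p.2)
   = n%:R * (c * \sum_(i < M) q ^+ i + n%:R * ln lambda * (c * q ^+ M)).
  rewrite -(pair_bigA _ (fun (j : 'I_n) (i : 'I_M.+1) =>
    penalty (ln lambda) n M i * (c * q ^+ i)))/=.
  rewrite sumr_const card_ord -[LHS]mulr_natl; congr (_ * _).
  rewrite big_ord_recr/= {2}/penalty ltnn; congr (_ + _).
  rewrite mulr_sumr; apply: eq_bigr => i _.
  by rewrite /penalty ltn_ord mul1r.
have : n%:R * (c * \sum_(i < M) q ^+ i) <= n%:R * lyapunov_defect H alpha.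
  by rewrite ler_wpM2l// /lyapunov_defect -/q -/c ler_wpM2l// sum_expr_le.
lra.
Qed.

(** * Existence and lower bound of the Lyapunov exponent *)

Theorem corollary1 (R : realType) (k : nat) (hk : (2 <= k)%N)
    (v : R -> R) (alpha : R) (halpha : 1 <= alpha)
    (v_anti_holder : anti_holder alpha v)
    (v_continuous : {within @circle R, continuous v})
    (v_bounded : [bounded v x | x in @circle R])
    (v_monotone : monotone_on_circle v) :
  exists C0 : R, 0 < C0 /\
    forall lambda : R, 0 < lambda ->
    forall E : R,
      cvgn (lyapunov_seq (expanding_map k) v lambda E) /\
      ln lambda - C0 < lyapunov (expanding_map k) v lambda E.
Proof.
move: v_anti_holder => [H [H0 antiv]].
have al0 : 0 < alpha by exact: lt_le_trans halpha.
have k0 : (0 < k)%N by exact: ltnW.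
have mv : measurable_fun (@circle R : set (measurableTypeR R)) v.
  by apply: subspace_continuous_measurable_fun => //; exact: measurable_circle.
have C0 : 0 <= lyapunov_defect H alpha.
  rewrite divr_ge0 ?mulr_ge0 ?powR_ge0// subr_ge0 /decay_rate.
  by rewrite expR_le1 oppr_le0 invr_ge0 ltW.
exists (lyapunov_defect H alpha + 1); split; first by rewrite ltr_wpDl.
move=> lambda l0 E.
have cvgL : cvgn (lyapunov_seq (expanding_map k) v lambda E).
  apply: (@subadditive_cvg R (mean_ln_cocycle k v lambda E)).
    exact: mean_ln_cocycle_ge0.
  by move=> m n; exact: mean_ln_cocycleD.
split => //.
apply: (@lt_le_trans _ _ (ln lambda - lyapunov_defect H alpha)); first lra.
apply: limr_ge => //; near=> n.
have n0 : (0 : R) < n%:R by rewrite ltr0n; near: n; exists 1%N.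
rewrite /lyapunov_seq mulrC ler_pdivlMr// mulrC.
exact: mean_ln_cocycle_ge.
Unshelve. all: by end_near. Qed.
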